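(* If $G$ is a connected graph with $n(G)\geq 3$, then $$\alpha(G)\geq \frac{a(G)+\operatorname{res}(G)}{\Delta(G)}.$$ Both hypotheses are necessary: there is a connected graph $G$ with $n(G)<3$ and $\Delta(G)\geq 1$ for which the inequality fails, and there is a disconnected graph $G$ with $n(G)\geq 3$ and $\Delta(G)\geq 1$ for which the inequality fails.
   Context: All graphs are finite, simple and undirected. For a graph $G$, $n(G)$ and $m(G)$ are the numbers of vertices and edges, $\Delta(G)$ is the maximum degree, and $\alpha(G)$ is the independence number. If $d_1\leq d_2\leq\cdots\leq d_n$ is the degree sequence of $G$, the annihilation number is $a(G)=\max\{k : \sum_{i=1}^k d_i\leq m(G)\}$. The Havel–Hakimi residue $\operatorname{res}(G)$ is defined as follows: starting from the degree sequence of $G$ in non-increasing order, repeatedly delete the first (largest) term $d$, subtract $1$ from each of the next $d$ terms, and re-sort in non-increasing order, until all remaining terms are $0$; $\operatorname{res}(G)$ is the number of zeros remaining. *)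

(* Defs.v *)
From mathcomp Require Import all_boot all_order all_algebra.

Set Implicit Arguments.
Unset Strict Implicit.
Unset Printing Implicit Defensive.

Record sgraph := SGraph {
  vertex :> finType;
  adj : rel vertex;
  adj_sym : symmetric adj;
  adj_irr : irreflexive adj }.

Definition num_vertices (G : sgraph) : nat := #|G|.

Definition edges (G : sgraph) : {set {set G}} :=
  [set E : {set G} | [exists x : G, exists y : G, adj x y && (E == [set x; y])]].

Definition num_edges (G : sgraph) : nat := #|edges G|.

Definition degree (G : sgraph) (x : G) : nat := #|[set y : G | adj x y]|.

Definition max_degree (G : sgraph) : nat := \max_(x : G) degree x.

Definition connected (G : sgraph) : bool :=
  [forall x : G, forall y : G, connect (@adj G) x y].

Definition independent (G : sgraph) (S : {set G}) : bool :=
  [forall x in S, forall y in S, ~~ adj x y].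

Definition independence_number (G : sgraph) : nat :=
  \max_(S : {set G} | independent S) #|S|.

Definition degrees (G : sgraph) : seq nat := [seq degree x | x <- enum G].

(* [take k] of the non-decreasing degree sequence is d_1, ..., d_k; k = 0 is
   always admissible. *)
Definition annihilation_number (G : sgraph) : nat :=
  \max_(k < (num_vertices G).+1 | sumn (take k (sort leq (degrees G))) <= num_edges G) k.

(* On degree sequences of graphs, the d terms following the first term d exist
   and are positive, so neither [take] nor the predecessor truncates. *)
Definition hh_step (s : seq nat) : seq nat :=
  if s is d :: t then sort geq (map predn (take d t) ++ drop d t) else [::].

(* [fuel] bounds the number of steps; [hh_reduce_all0] shows that [size s] is
   always enough to reach a sequence of zeros. *)
Fixpoint hh_reduce (fuel : nat) (s : seq nat) : seq nat :=
  if all (pred1 0) s then s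
  else if fuel is fuel'.+1 then hh_reduce fuel' (hh_step s) else s.

Lemma hh_reduce_all0 fuel s : size s <= fuel -> all (pred1 0) (hh_reduce fuel s).
Proof.
elim: fuel s => [|f IH] [|d t] //= le_tf.
case: ifP => //= _; apply: IH.
by rewrite size_sort size_cat size_map -size_cat cat_take_drop.
Qed.

Definition residue (G : sgraph) : nat :=
  let s := sort geq (degrees G) in count_mem 0 (hh_reduce (size s) s).

(* Main.v *)
Require Import Defs.
From mathcomp Require Import all_boot all_order all_algebra.
From mathcomp Require Import zify.

Set Implicit Arguments.
Unset Strict Implicit.
Unset Printing Implicit Defensive.

(**
The inequality splits as residue <= alpha (Favaron, Maheo and Sacle) and
annihilation number <= (Delta - 1) alpha.

For the first, repeatedly deleting a vertex of maximum degree from the graph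
yields degree sequences that dominate the Havel-Hakimi ones. The number of edges
removed by k Havel-Hakimi steps is monotone for dominance, so that as many
vertex deletions as there are Havel-Hakimi steps destroy all edges. Monotonicity
is proved by following a unit transfer towards the largest degree through the
steps: it alternates between a domination and the deletion of an edge with one
low end.

For the second, the top degrees give a Delta + m <= n Delta, and m >= n - 1.
If Delta >= 3 and the graph is not K_{Delta+1}, then n <= Delta alpha, the
independence version of Brooks' theorem: a clique on Delta vertices is removed
after joining two of its outer neighbours; without such cliques a maximum
independent set is counted. The cases K_{Delta+1} and Delta = 2 are direct.
The counterexamples are K_2 and 2 K_2.
*)

(** * Profiles of degree sequences *)

(** The first zero, i.e. the largest degree. Searching up to [P 0] suffices because a profile drops
    by at least one at each level before it. *)
Definition top (P : nat -> nat) : nat :=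
  find (fun t => P t == 0) (iota 0 (P 0).+1).

(* The profile of a multiset of degrees is [t |-> \sum_d (d - t)] (truncated
   subtraction): a convex function that vanishes exactly from the largest
   degree on. Dropping the largest degree [D] and decrementing the next [D]
   ones lowers the value at [t < D] by [D - t] plus
   [minn D (P t - P t.+1 - 1)], as [P t - P t.+1] degrees exceed [t]. *)
Definition hstep (P : nat -> nat) (t : nat) : nat :=
  if t < top P then maxn (P t + t - (top P).*2) (P t.+1 + t.+1 - top P) else 0.

(** The number of edges removed by [k] Havel-Hakimi steps, each removing as many as the largest
    degree. *)
Fixpoint hsum (k : nat) (P : nat -> nat) : nat :=
  if k is k'.+1 then top P + hsum k' (hstep P) else 0.

Definition convex (P : nat -> nat) := forall t, (P t.+1).*2 <= P t + P t.+2.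

Definition profile (P : nat -> nat) (D : nat) :=
  convex P /\ forall t, (P t == 0) = (D <= t).

Lemma convex_gap P t u : convex P -> t <= u -> P u + P t.+1 <= P t + P u.+1.
Proof.
move=> cP /subnK <-; elim: (u - t) => [|k IH]; first by rewrite ?add0n ?subn0; lia.
by have := cP (k + t); rewrite addSn; lia.
Qed.

Lemma profile_decr P D t : profile P D -> t < D -> P t.+1 < P t.
Proof.
move=> [cP zP] ltD.
have := @convex_gap P t D.-1 cP; have := zP D; have := zP D.-1.
by rewrite prednK; lia.
Qed.

Lemma profile_ge P D t : profile P D -> D <= P t + t.
Proof.
move=> pP; have [leD|] := leqP D t; first by rewrite ?add0n ?subn0; lia.
move=> ltD; rewrite -(subKn (ltnW ltD)).
elim: (D - t) (leq_subr t D) => [|k IH] lek; first by rewrite ?add0n ?subn0; lia.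
have {}IH := IH (ltnW lek).
have := @profile_decr P D (D - k.+1) pP.
by rewrite (_ : (D - k.+1).+1 = D - k); lia.
Qed.

Lemma topE P D : profile P D -> top P = D.
Proof.
move=> pP; have [cP zP] := pP.
have leD : D <= P 0 by have := @profile_ge P D 0 pP; lia.
have hD : has (fun t => P t == 0) (iota 0 (P 0).+1).
  by apply/hasP; exists D; rewrite ?mem_iota ?zP //; lia.
have := hD; rewrite has_find size_iota => ltt.
apply/eqP; rewrite eqn_leq; apply/andP; split.
  rewrite leqNgt; apply/negP => ltD.
  by have := before_find 0 ltD; rewrite nth_iota ?zP ?leqnn //; lia.
by have := nth_find 0 hD; rewrite nth_iota // zP.
Qed.

Lemma convex_profile P N :
  convex P -> (forall t, N <= t -> P t = 0) -> exists2 D, D <= N & profile P D.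
Proof.
move=> cP zP.
have exD : exists t, P t == 0 by exists N; rewrite zP.
case: (ex_minnP exD) => D /eqP PD0 minD; exists D.
  by apply: minD; rewrite zP.
split=> // t; apply/eqP/idP => [/eqP/minD //|leDt].
have decr s : P s.+1 <= P s.
  have := @convex_gap P s (maxn s N) cP (leq_maxl _ _).
  by have := zP (maxn s N); have := zP (maxn s N).+1; lia.
have : P t <= P D.
  by rewrite -(subnK leDt); elim: (t - D) => // k IH; have := decr (k + D); rewrite addSn; lia.
by lia.
Qed.

Section Step.
Variables (P : nat -> nat) (D : nat).
Hypothesis pP : profile P D.

Lemma hstepE t :
  hstep P t = if t < D then maxn (P t + t - D.*2) (P t.+1 + t.+1 - D) else 0.
Proof. by rewrite /hstep (topE pP). Qed.

(** Both branches of [hstep] are convex, hence so is their maximum; at the cut-off [D] the shifted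
    branch has just reached 0. *)
Lemma hstep_profile : exists2 D', D' <= D & profile (hstep P) D'.
Proof.
apply: convex_profile => [t|t leDt]; last by rewrite hstepE ltnNge leDt.
have [cP zP] := pP.
have := cP t; have := cP t.+1; have := cP t.+2.
have := @profile_ge _ _ t.+1 pP; have := @profile_ge _ _ t.+2 pP.
have := @profile_ge _ _ t.+3 pP.
have := zP t.+1; have := zP t.+2; have := zP t.+3.
rewrite !hstepE.
case: (ltnP t D); case: (ltnP t.+1 D); case: (ltnP t.+2 D); lia.
Qed.

(** [P t - P t.+1] counts the degrees above [t] and never increases. From [s] on there are at most
    [D.+1] of them: room for the deleted one and the [D] decremented ones. *)
Lemma gap_threshold :
  exists2 s, s <= D & forall t, (P t <= P t.+1 + D.+1) = (s <= t).
Proof.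
have [cP zP] := pP.
have PD : P D <= P D.+1 + D.+1 by have := zP D; lia.
have exs : exists s, P s <= P s.+1 + D.+1 by exists D.
case: (ex_minnP exs) => s Ps mins; exists s; first exact: mins.
move=> t; apply/idP/idP => [/mins //|lest].
by have := convex_gap cP lest; lia.
Qed.

(** Here only the deleted term leaves the entries above [t], whose number falls from at least [D.+2]
    to at least [D.+1]. This yields the second clause of [lowpair] after a step. *)
Lemma hstep_gap s t :
    (forall t, (P t <= P t.+1 + D.+1) = (s <= t)) -> t.+1 < s -> s <= D ->
  hstep P t.+1 + D < hstep P t.
Proof.
move=> sP lts leD; rewrite !hstepE.
have := sP t; have := sP t.+1; have := @profile_ge _ _ t.+2 pP.
case: (ltnP t D); case: (ltnP t.+1 D); lia.
Qed.

End Step.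

Lemma hsum0 k P : profile P 0 -> hsum k P = 0.
Proof.
elim: k P => //= k IH P pP; rewrite (topE pP).
by have [E] := hstep_profile pP; rewrite leqn0 => /eqP -> /IH.
Qed.

Lemma hstep_mono P Q D :
  profile P D -> profile Q D -> (forall t, P t <= Q t) ->
  forall t, hstep P t <= hstep Q t.
Proof.
move=> pP pQ lePQ t; rewrite (hstepE pP) (hstepE pQ).
by case: ltnP => // _; have := lePQ t; have := lePQ t.+1; lia.
Qed.

(** * Low pairs *)

(* Distinct entries [a] and [b] can be decremented without losing convexity, and
   at least [D.+1] entries are larger than [t] whenever [t.+1 < minn a b]. The
   second clause is essential: deleting an edge between two large entries can
   lower the residue. *)
Definition lowpair (P : nat -> nat) (D a b : nat) :=
  (forall v, (P v.+1).*2 + (v.+1 == a) + (v.+1 == b) <= P v + P v.+2) /\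
  (forall t, t.+1 < a -> t.+1 < b -> P t.+1 + D < P t).

(** * Low pairs through one step *)

Section StepPair.
Variables (P : nat -> nat) (D D' s : nat).
Hypotheses (pP : profile P D) (pP' : profile (hstep P) D').
Hypotheses (sP : forall t, (P t <= P t.+1 + D.+1) = (s <= t)) (leD : s <= D).

Lemma top_hstep_le : D' <= D.
Proof. by have [E lE /topE tE] := hstep_profile pP; rewrite -(topE pP') tE. Qed.

Lemma top_hstep_lt : s < D -> D' < D.
Proof.
move=> ltD; have [_ z'] := pP'; rewrite -(prednK (leq_ltn_trans _ ltD)) // ltnS -z'.
rewrite (hstepE pP) (_ : D.-1.+1 = D); last by lia.
by have := sP D.-1; have [_ /(_ D)] := pP; rewrite prednK; case: ltnP; lia.
Qed.

Lemma hstep_out t : D <= t -> hstep P t = 0.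
Proof. by rewrite (hstepE pP) leqNgt; case: (t < D). Qed.

Lemma hstep_ge_keep t : t < D -> P t + t <= hstep P t + D.*2.
Proof. by move=> ltD; rewrite (hstepE pP) ltD; lia. Qed.

Lemma hstep_ge_shift t : t < D -> P t.+1 + t.+1 <= hstep P t + D.
Proof. by move=> ltD; rewrite (hstepE pP) ltD; lia. Qed.

(* Below [s] more than [D.+1] entries exceed [t], so all [D] decrements happen
   above [t]; from [s] on every remaining entry above [t] is decremented. *)
Lemma hstep_keep t : t < s -> hstep P t + D.*2 = P t + t.
Proof.
move=> lts; have ltD : t < D by exact: leq_trans leD.
rewrite (hstepE pP) ltD.
by have := sP t; have := @profile_ge _ _ t.+1 pP; lia.
Qed.

Lemma hstep_shift t : s <= t -> t < D -> hstep P t + D = P t.+1 + t.+1.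
Proof.
move=> lest ltD; rewrite (hstepE pP) ltD.
by have := sP t; have := @profile_ge _ _ t.+1 pP; lia.
Qed.

(** Above [s] every entry is decremented, so the pair moves down with them. The last hypothesis says
    that some entry [D] outside the pair is available for deletion. *)
Lemma lowpair_high a b :
    s < b -> b <= a -> lowpair P D a b -> (a == D) + (b == D) < P D.-1 ->
  lowpair (hstep P) D' a.-1 b.-1.
Proof.
move=> ltb leba [C1 C2] xD; have [cP zP] := pP; split.
  move=> v; rewrite (_ : (v.+1 == a.-1) = (v.+2 == a)); last by lia.
  rewrite (_ : (v.+1 == b.-1) = (v.+2 == b)); last by lia.
  move: (C1 v.+1) (pP'.1 v) => C1v cv.
  have [|E] := boolP ((v.+2 != a) && (v.+2 != b)); first by lia.
  have ltD : v.+1 < D by have := zP v.+1; have := zP v.+3; lia.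
  have lts: s <= v.+1 by lia.
  have := hstep_shift lts ltD; have := hstep_ge_shift (ltnW ltD).
  have [ltD2|leD2] := ltnP v.+2 D; first by have := hstep_ge_shift ltD2; lia.
  have := hstep_out leD2; have := zP v.+2; have := zP v.+3; have ED : v.+2 = D by lia.
  by move: xD; rewrite -ED /=; lia.
move=> t; have [lts _ _|lest] := ltnP t.+1 s.
  by have := hstep_gap pP sP lts leD; have := top_hstep_le; lia.
move=> lta ltb'; have := C2 t.+1; have := top_hstep_lt.
have [tD|ltD] := leqP D t.+1; first by have := zP t.+1; lia.
by have := hstep_shift lest ltD; have := hstep_ge_shift (ltnW ltD); lia.
Qed.

(** The second difference at [s] counts the entries equal to [s] after the step. Of the entries at
    least [s], one is deleted and [D] are decremented; the rest stay, and equal [s] because at most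
    [D.+1] entries exceed [s]. *)
Lemma hstep_entry v : v.+1 = s ->
  (hstep P v.+1).*2 + P v <= hstep P v + hstep P v.+2 + P v.+1 + D.+1.
Proof.
move=> Es; have [cP zP] := pP; have := @hstep_keep v; have := cP s.
case: (ltnP s D) => ltD.
  have := hstep_shift (leqnn s) ltD; rewrite -Es in ltD *.
  have [ltD2|leD2] := ltnP v.+2 D; first by have := hstep_ge_shift ltD2; lia.
  by have := hstep_out leD2; have := zP v.+2; have := zP v.+3; have := zP v.+1; lia.
rewrite Es (hstep_out ltD) (@hstep_out s.+1); last by lia.
by have := zP s; have := zP s.+1; lia.
Qed.

(** The entry [a] is decremented; its partner is one of the entries left at [s]. *)
Lemma lowpair_mid a :
    s < a -> (P a).*2 < P a.-1 + P a.+1 -> (a == D) < P D.-1 ->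
  lowpair (hstep P) D' a.-1 s.
Proof.
move=> lta ea xD; have [cP zP] := pP; split=> [v|t _ lts]; last first.
  by have := hstep_gap pP sP lts leD; have := top_hstep_le; lia.
rewrite (_ : (v.+1 == a.-1) = (v.+2 == a)); last by lia.
have leaD : a <= D by have := zP a.-1; have := zP a; have := zP a.+1; lia.
move: (@hstep_entry v) (sP v) (pP'.1 v) => ev sv cv.
have [Ea|Ea] := eqVneq v.+2 a; last by have [Es|] := eqVneq v.+1 s; lia.
rewrite -Ea /= in ea leaD lta xD; have ltD : v.+1 < D by lia.
have := hstep_shift lta ltD; have := @hstep_ge_shift v; have := @hstep_keep v.
have := zP v.+2; have := zP v.+3.
have [ltD2|leD2] := ltnP v.+2 D; first by have := hstep_ge_shift ltD2; lia.
have ED : v.+2 = D by lia.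
by have := hstep_out leD2; move: xD; rewrite -ED /=; lia.
Qed.

(** An entry below [s] is untouched; its partner is again an entry left at [s]. *)
Lemma lowpair_low b :
    b < s -> (0 < b -> (P b).*2 < P b.-1 + P b.+1) ->
  lowpair (hstep P) D' s b.
Proof.
move=> ltb eb; have [cP zP] := pP; split=> [v|t lts _]; last first.
  by have := hstep_gap pP sP lts leD; have := top_hstep_le; lia.
move: (@hstep_entry v) (sP v) (pP'.1 v) => ev sv cv.
have [Eb|Eb] := eqVneq v.+1 b; last by have [Es|] := eqVneq v.+1 s; lia.
rewrite -Eb /= in eb ltb.
have := @hstep_keep v; have := @hstep_keep v.+1; have := zP v.+2.
have [ltD|leD'] := ltnP v.+2 D; first by have := hstep_ge_keep ltD; lia.
by have := hstep_out leD'; lia.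
Qed.

(** Two entries stay at [s] unless exactly [D.+2] entries were at least [s]. Then only one stays,
    but the second hypothesis forces an entry [s] to be decremented to [s.-1]. *)
Lemma lowpair_eq : 0 < s ->
    (P s.-1 = P s + D.+2 -> P s <= P s.+1 + D) ->
  lowpair (hstep P) D' s (s - (P s.-1 == P s + D.+2)).
Proof.
move=> s0 es; have [cP zP] := pP; split=> [v|t lts _]; last first.
  by have := hstep_gap pP sP lts leD; have := top_hstep_le; lia.
move: (@hstep_entry v) (sP v) (pP'.1 v) => ev sv cv.
have [Es|] := eqVneq v.+1 s.
  by move: es; rewrite -Es /=; case: eqP => /=; lia.
case: (P s.-1 =P P s + D.+2) => [Ed|_]; last by rewrite subn0; lia.
have [Es _|] := eqVneq v.+2 s; last by lia.
move: Ed es; rewrite -Es /= => Ed /(_ Ed) es.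
have := @hstep_keep v; have := @hstep_keep v.+1; have := cP v.
have := zP v.+2; have := zP v.+3.
have [ltD|leD'] := ltnP v.+2 D; first by have := hstep_ge_shift ltD; lia.
by have := hstep_out leD'; lia.
Qed.

(** The cases follow the position of [a] and [b] relative to [s]. Entries above [s] are decremented;
    the largest entry that is at most [s] is raised to [s], which only weakens the bound. *)
Lemma hstep_lowpair x a b :
    profile x D -> b <= a -> lowpair P D a b ->
    (forall t, P t = x t + (t < a) + (t < b)) ->
  exists a' b', lowpair (hstep P) D' a' b' /\
    forall t, hstep P t <= hstep x t + (t < a') + (t < b').
Proof.
move=> px leba lpab xP; have [C1 _] := lpab; have [cP zP] := pP.
have [D0|D0] := posnP D.
  exists 0, 0; split=> [|t]; last by rewrite hstep_out ?D0.
  by split=> // v; have := pP'.1 v; lia.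
have leaD : a <= D.
  by have := zP D; have := zP a.-1; have := xP a.-1; case: (a) => // n /=; lia.
have xD : (a == D) + (b == D) < P D.-1.
  by have := xP D.-1; have := px.2 D.-1; lia.
have keep t : t < s -> hstep P t <= hstep x t + (t < a) + (t < b).
  move=> lts; have ltD := leq_trans lts leD; have := hstep_keep lts.
  by rewrite (hstepE px) ltD; have := xP t; lia.
have shift t : s <= t -> hstep P t <= hstep x t + (t.+1 < a) + (t.+1 < b).
  move=> lest; have [leDt|ltD] := leqP D t; first by rewrite hstep_out.
  have := hstep_shift lest ltD.
  by rewrite (hstepE px) ltD; have := xP t.+1; lia.
have [ltsb|lebs] := ltnP s b.
  exists a.-1, b.-1; split=> [|t]; first exact: lowpair_high.
  have := keep t; have := shift t; lia.
have ent v : 0 < v -> (v == a) || (v == b) -> (P v).*2 < P v.-1 + P v.+1.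
  by case: v => //= v _; have := C1 v; lia.
have [ltsa|leas] := ltnP s a.
  exists a.-1, s; split=> [|t]; last by have := keep t; have := shift t; lia.
  by apply: lowpair_mid => //; [apply: ent; lia|lia].
have [ltbs|lesb] := ltnP b s.
  exists s, b; split=> [|t]; last by have := keep t; have := shift t; lia.
  by apply: lowpair_low => // b0; apply: ent; lia.
have [Ea Eb] : a = s /\ b = s by lia.
have [s0|s0] := posnP s.
  exists 0, 0; split=> [|t]; last by have := shift t; lia.
  by split=> // v; have := pP'.1 v; lia.
exists s, (s - (P s.-1 == P s + D.+2)); split=> [|t].
  by apply: lowpair_eq => // Ed; have := C1 s.-1; rewrite prednK //; lia.
have [lest|lts] := leqP s t; first by have := shift t lest; lia.
have := keep t lts; case: eqP => [Ed|_]; last by lia.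
(* At [s.-1] the pair [s], [s.-1] allows a loss of one only; the shifted branch of [hstep x]
   achieves it. *)
have [Et|] := eqVneq t.+1 s; last by lia.
have := hstep_keep lts; have ltD := leq_trans lts leD.
by rewrite (hstepE px) ltD; have := xP t.+1; move: Ed; rewrite -Et /=; lia.
Qed.

(** [f] arises by moving a unit from the second largest degree, if any, to the largest. *)
Lemma hstep_raise f :
    profile f D.+1 -> (forall t, f t = maxn (P t) (D.+1 - t)) ->
  exists a' b', lowpair (hstep P) D' a' b' /\
    forall t, hstep P t <= hstep f t + (t < a') + (t < b').
Proof.
move=> pf fP; have [cP zP] := pP.
have [D0|D0] := posnP D.
  exists 0, 0; split=> [|t]; last by rewrite hstep_out ?D0.
  by split=> // v; have := pP'.1 v; lia.
(* [y] will be the second largest degree, or 0 if there is none: exactly one entry exceeds each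
   level from [y] to [D.-1]. *)
have exy : exists t, P t + t <= D by exists D; have := zP D; lia.
case: (ex_minnP exy) => y Py miny.
have leyD : y <= D by apply: miny; have := zP D; lia.
have yP t : y <= t -> t <= D -> P t + t = D.
  move=> leyt letD; have := profile_ge t pP.
  suff : P t + t <= P y + y by lia.
  rewrite -(subnK leyt); have : t - y <= D - y by lia.
  elim: (t - y) => //= k IH ltk; rewrite addSn; have := IH (ltnW ltk).
  by have := @profile_decr P D (k + y) pP; lia.
have keep t : t < s -> hstep P t <= (hstep f t).+1 + (t < y).
  move=> lts; have ltD := leq_trans lts leD; have := hstep_keep lts.
  by rewrite (hstepE pf) (leqW ltD); have := fP t; have := yP t; lia.
have shift t : s <= t -> hstep P t <= hstep f t + (t.+1 < y).
  move=> lest; have [leDt|ltD] := leqP D t; first by rewrite hstep_out.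
  have := hstep_shift lest ltD.
  by rewrite (hstepE pf) (leqW ltD); have := fP t.+1; have := yP t.+1; lia.
have ey : 0 < y -> D < P y.-1 + y.-1 by have := miny y.-1; lia.
have [ltsy|leys] := ltnP s y.
  exists y.-1, s; split=> [|t]; last by have := keep t; have := shift t; lia.
  apply: lowpair_mid => //.
    by have := yP y; have := zP y.+1; have := profile_ge y.+1 pP; lia.
  by case: eqP => [<-|_]; [lia|have := zP D.-1; lia].
have [s0|s0] := posnP s.
  exists 0, 0; split=> [|t]; last by have := shift t; lia.
  by split=> // v; have := pP'.1 v; lia.
have es : P s <= P s.+1 + D.
  by have := yP s leys leD; have := zP s; lia.
exists s, (s - (P s.-1 == P s + D.+2)); split=> [|t].
  exact: lowpair_eq.
have [lest|lts] := leqP s t; first by have := shift t lest; lia.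
have := keep t lts; case: eqP => [Ed|_]; last by lia.
have [Et|] := eqVneq t.+1 s; last by lia.
have := hstep_keep lts; have ltD := leq_trans lts leD.
rewrite (hstepE pf) (leqW ltD); have := fP t.+1; have := yP t.+1.
by move: Ed; rewrite -Et /=; lia.
Qed.
End StepPair.

(** * Monotonicity under dominance *)

Lemma lowpairC P D a b : lowpair P D a b -> lowpair P D b a.
Proof.
move=> [C1 C2]; split=> [v|t lta ltb]; last exact: C2.
by rewrite addnAC.
Qed.

Lemma raise_profile P D :
  profile P D -> profile (fun t => maxn (P t) (D.+1 - t)) D.+1.
Proof.
move=> [cP zP]; split=> t; first by have := cP t; lia.
by have := zP t; lia.
Qed.

(** The two decremented entries are distinct, so no entry, and hence not the largest, falls by more
    than one. *)
Lemma lower_profile P D a b :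
    profile P D -> b <= a -> lowpair P D a b ->
  exists x D', [/\ profile x D', D' <= D, D <= D'.+1 &
    forall t, P t = x t + (t < a) + (t < b)].
Proof.
move=> pP leba [C1 _]; have [cP zP] := pP.
have leaD : a <= D.
  case: (posnP a) => [->//|a0].
  by have := C1 a.-1; have := zP a.-1; have := zP a.+1; rewrite prednK //; lia.
have gt2 t : (t < a) + (t < b) <= P t.
  have := profile_ge t pP; have := C1 t; have := zP t.+1; have := zP t.+2; lia.
pose x t := P t - (t < a) - (t < b).
have xP t : P t = x t + (t < a) + (t < b) by have := gt2 t; rewrite /x; lia.
have cx : convex x.
  by move=> t; have := C1 t; have := xP t; have := xP t.+1; have := xP t.+2; lia.
have zx t : D <= t -> x t = 0 by move=> leDt; have := xP t; have := zP t; lia.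
have [D' leD' px] := convex_profile cx zx; exists x, D'; split=> //.
rewrite leqNgt; apply/negP => ltD'.
have zx2 : x D.-2 = 0 by apply/eqP; rewrite px.2; lia.
have D2 : D = D.-2.+2 by lia.
have := profile_ge D.-2 pP; have := xP D.-2; have := C1 D.-2; have := C1 D.-1.
rewrite prednK; last by lia.
rewrite {1 2 3 5 6 7}D2 /=.
have := zP D; have := zP D.+1; have := cP D.-2; rewrite -!D2.
have := profile_ge D.-1 pP.
by rewrite (_ : D.-2.+1 = D.-1); lia.
Qed.

(** The smaller top gains two in the unshifted branch and one in the shifted branch. If the latter
    loses two, both [a] and [b] exceed [t.+1], and the second clause of [lowpair] makes the
    unshifted branch large enough. *)
Lemma hstep_lower P D a b x :
    profile P D -> b <= a -> lowpair P D a b -> profile x D.-1 -> 0 < D ->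
    (forall t, P t = x t + (t < a) + (t < b)) ->
  forall t, hstep P t <= hstep x t.
Proof.
move=> pP leba [C1 C2] px D0 xP t; have [cP zP] := pP.
rewrite (hstepE pP) (hstepE px); case: ltnP => // ltD.
have := xP t; have := xP t.+1; have := xP D.-1.
have := zP D; have := px.2 D.-1; have := C2 t.
have [ltD1|leD] := ltnP t D.-1; first by lia.
have -> : t = D.-1 by lia.
by rewrite prednK //; lia.
Qed.

(* Raising the largest entry by one and lowering the second largest by one turns,
   after one step, into the deletion of a low pair; conversely the deletion of a
   low pair either persists through a step or becomes a domination. *)
Lemma hsum_mono_lowpair n :
  (forall P Q D E, profile P D -> profile Q E -> (forall t, P t <= Q t) ->
     hsum n P <= hsum n Q) /\
  (forall P Q D E a b, profile P D -> profile Q E -> lowpair P D a b ->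
     (forall t, P t <= Q t + (t < a) + (t < b)) -> hsum n P <= (hsum n Q).+1).
Proof.
elim: n => [//|n [IHM IHX]].
have M P Q D E : profile P D -> profile Q E -> (forall t, P t <= Q t) ->
    hsum n.+1 P <= hsum n.+1 Q.
  move=> pP pQ lePQ; have leDE : D <= E.
    by have := lePQ E; have := pP.2 E; have := pQ.2 E; lia.
  elim: {D}(E - D) {-2}D (erefl (E - D)) leDE P pP lePQ => [|k IH] D Ek leDE P pP lePQ.
    have ED : D = E by lia.
    rewrite /= (topE pP) (topE pQ) ED leq_add2l; subst D.
    have [D1 _ pP1] := hstep_profile pP; have [E1 _ pQ1] := hstep_profile pQ.
    exact: IHM pP1 pQ1 (hstep_mono pP pQ lePQ).
  (* [f] has a top larger by one and stays below [Q]. Passing from [P] to [f] costs at most one in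
     the later steps, which the larger top repays. *)
  pose f t := maxn (P t) (D.+1 - t).
  have pf : profile f D.+1 := raise_profile pP.
  have [s leD sP] := gap_threshold pP.
  have [D1 _ pP1] := hstep_profile pP; have [F1 _ pf1] := hstep_profile pf.
  have [a [b [lp le]]] := hstep_raise pP pP1 sP leD pf (fun t => erefl).
  have := IHX _ _ _ _ _ _ pP1 pf1 lp le.
  have := IH D.+1 _ _ f pf; rewrite /= (topE pP) (topE pf) => {}IH.
  have := IH ltac:(lia) ltac:(lia) => {}IH; rewrite addSn in IH.
  suff : forall t, f t <= Q t by move/IH; lia.
  by move=> t; have := lePQ t; have := profile_ge t pQ; rewrite /f; lia.
split=> // P Q D E a b pP pQ lp le.
wlog leba : a b lp le / b <= a.
  move=> H; have [|/ltnW] := leqP b a; first exact: H.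
  by apply: H; [exact: lowpairC|move=> t; rewrite addnAC].
have [x [D' [px leD' leD xP]]] := lower_profile pP leba lp.
(* Domination for [n.+1], just proved, replaces [Q] by the exact difference [x]. *)
apply: (@leq_trans (hsum n.+1 x).+1); last first.
  by rewrite ltnS; apply: (M _ _ _ _ px pQ) => t; have := xP t; have := le t; lia.
have [D1 _ pP1] := hstep_profile pP; have [x1 _ px1] := hstep_profile px.
rewrite /= (topE pP) (topE px).
have [ED|ltD] := leqP D D'.
  have {leD' ED} ED : D' = D by lia.
  subst D'; have [s leDs sP] := gap_threshold pP.
  have [a' [b' [lp' le']]] := hstep_lowpair pP pP1 sP leDs px leba lp xP.
  by have := IHX _ _ _ _ _ _ pP1 px1 lp' le'; lia.
have ED : D' = D.-1 by lia.
subst D'; have := IHM _ _ _ _ pP1 px1 (hstep_lower pP leba lp px _ xP); lia.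
Qed.

Lemma hsum_mono n P Q D E :
  profile P D -> profile Q E -> (forall t, P t <= Q t) -> hsum n P <= hsum n Q.
Proof. by move=> pP pQ; apply: (hsum_mono_lowpair n).1 pP pQ. Qed.

(** * The residue and the independence number *)

Definition psum (s : seq nat) (t : nat) : nat := \sum_(x <- s) (x - t).

Lemma psum_profile s : profile (psum s) (\max_(x <- s) x).
Proof.
split=> t; rewrite /psum.
  elim: s => [|x s IH]; first by rewrite !big_nil.
  by rewrite !big_cons; lia.
elim: s => [|x s IH]; first by rewrite !big_nil.
by rewrite !big_cons geq_max addn_eq0 IH subn_eq0.
Qed.

Lemma count_take_sorted u d t : sorted geq t ->
  minn d (count (ltn u) t) <= count (ltn u) (take d t).
Proof.
elim: t d => [|x t IH] [|d] //=; first by rewrite min0n.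
move=> st; have := IH d (path_sorted st).
have [ltu|leu] := ltnP u x; first by rewrite /=; lia.
move=> _; suff -> : count (ltn u) t = 0 by lia.
apply/eqP; rewrite -leqn0 leqNgt -has_count; apply/hasPn => y.
rewrite path_sortedE in st; last by move=> a b c /= ab bc; exact: leq_trans bc ab.
by have /andP [/allP le _] := st; move=> /le /=; lia.
Qed.

Lemma psum_hh_step s : sorted geq s ->
  forall u, psum (hh_step s) u <= hstep (psum s) u.
Proof.
case: s => [|d t] st u; first by rewrite /psum big_nil.
have le_d : forall x, x \in t -> x <= d.
  move: st; rewrite /= path_sortedE; last by move=> a b c /= ab bc; exact: leq_trans bc ab.
  by case/andP=> /allP.
have topd : \max_(x <- d :: t) x = d.
  rewrite big_cons; apply/maxn_idPl; apply/bigmax_leqP_seq => x xt _; exact: le_d.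
have pP := psum_profile (d :: t); rewrite topd in pP.
rewrite (hstepE pP) /hh_step /psum (perm_big _ (permEl (perm_sort _ _))) /=.
rewrite big_cat big_map /= !big_cons.
have split_t v : \sum_(x <- t) (x - v) =
    \sum_(x <- take d t) (x - v) + \sum_(x <- drop d t) (x - v).
  by rewrite -[in LHS](cat_take_drop d t) big_cat.
have drop1 r : \sum_(x <- r) (x - u) = \sum_(x <- r) (x.-1 - u) + count (ltn u) r.
  elim: r => [|x r IH]; first by rewrite !big_nil.
  by rewrite !big_cons IH /=; case: ltnP; lia.
have shift1 r : \sum_(x <- r) (x.-1 - u) = \sum_(x <- r) (x - u.+1).
  by apply: eq_bigr => x _; lia.
have := count_take_sorted u d (path_sorted st).
have := drop1 (take d t); have := drop1 t; have := shift1 t; rewrite (split_t u).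
case: ltnP => [ltu|leu]; first by lia.
have -> : \sum_(x <- take d t) (x.-1 - u) = 0.
  by apply: big1_seq => x /= /mem_take /le_d; lia.
have -> : \sum_(x <- drop d t) (x - u) = 0.
  by apply: big1_seq => x /= /mem_drop /le_d; lia.
by [].
Qed.

Lemma psum_hh_step0 d t : psum (d :: t) 0 <= psum (hh_step (d :: t)) 0 + d.*2.
Proof.
rewrite /psum (perm_big _ (permEl (perm_sort _ _))) /= big_cat big_map /= big_cons.
rewrite -{1}(cat_take_drop d t) big_cat /=.
suff : \sum_(x <- take d t) (x - 0) <= \sum_(x <- take d t) (x.-1 - 0) + d by lia.
have : size (take d t) <= d by rewrite size_take; case: ltnP.
move: (take d t) => r; elim: r d => [|x r IHr] d //= le_r; first by rewrite big_nil.
by rewrite !big_cons; have := IHr d.-1; lia.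
Qed.

(** [k] is the number of steps until all terms vanish; each shortens the list by one, and together
    they account for every edge. *)
Lemma hh_reduce_hsum fuel s : sorted geq s -> size s <= fuel ->
  exists2 k, k + count_mem 0 (hh_reduce fuel s) = size s &
    psum s 0 <= (hsum k (psum s)).*2.
Proof.
elim: fuel s => [|fuel IH] s st le_s; rewrite /=.
  by exists 0; case: s le_s {st} => //= _; rewrite /psum big_nil.
case: ifP => [all0|_].
  exists 0; first by apply/eqP; rewrite add0n -all_count.
  rewrite /psum big1_seq // => x /= xs; have /allP/(_ x xs)/eqP := all0; lia.
case: s st le_s => [_ _|d t st le_s].
  by exists 0; rewrite /psum ?big_nil //=; case: (fuel).
have sst : sorted geq (hh_step (d :: t)) by apply: sort_sorted; move=> a b; apply: leq_total.
have size_hh : size (hh_step (d :: t)) = size t.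
  by rewrite /= size_sort size_cat size_map -size_cat cat_take_drop.
have [|k Ek le_k] := IH _ sst; first by rewrite size_hh.
exists k.+1; first by rewrite addSn Ek size_hh.
have pP := psum_profile (d :: t); have [E _ pP'] := hstep_profile pP.
have := hsum_mono k (psum_profile _) pP' (psum_hh_step st).
rewrite /hsum -/hsum (topE pP); set m := \max_(x <- _) x.
have lem : d <= m by rewrite /m big_cons leq_maxl.
by have := psum_hh_step0 d t; lia.
Qed.

(** * Deleting vertices of maximum degree *)

Section Graph.
Variables (T : finType) (e : rel T).
Hypotheses (e_sym : symmetric e) (e_irr : irreflexive e).
Implicit Types (W : {set T}) (v : T).

Definition deg_in W v : nat := #|[set u in W | e v u]|.

Definition gsum W t : nat := \sum_(v in W) (deg_in W v - t).

Lemma gsumE W t : gsum W t = psum [seq deg_in W v | v <- enum W] t.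
Proof. by rewrite /psum big_map big_enum. Qed.

Lemma gsum_profile W : profile (gsum W) (\max_(v in W) deg_in W v).
Proof.
have [c z] := psum_profile [seq deg_in W v | v <- enum W].
rewrite big_map big_enum in z.
by split=> t; rewrite ?gsumE; [apply: c|apply: z].
Qed.

Lemma deg_inD1 W v u : v \in W -> deg_in W u = deg_in (W :\ v) u + e u v.
Proof.
move=> vW; rewrite /deg_in (cardsD1 v) inE vW /= addnC; congr (_ + _).
by apply: eq_card => x; rewrite !inE andbA.
Qed.

Lemma deg_in_sum W v : deg_in W v = \sum_(u in W) e u v.
Proof.
rewrite /deg_in -sum1_card big_mkcond [RHS]big_mkcond; apply: eq_bigr => u _.
by rewrite inE e_sym; case: (u \in W); case: (e u v).
Qed.

(** Only neighbours of [v] lose one, and only degrees above [t] are felt at level [t]; both counts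
    bound the loss. *)
Lemma gsumD1 W v t : v \in W ->
  gsum W t <= gsum (W :\ v) t + (deg_in W v - t) +
    minn (deg_in W v) (\sum_(u in W :\ v) (t < deg_in W u)).
Proof.
move=> vW; rewrite /gsum (big_setD1 v) //= addnC [leqRHS]addnAC leq_add2r.
have -> : deg_in W v = \sum_(u in W :\ v) e u v.
  by rewrite deg_in_sum (big_setD1 v) //= e_irr.
rewrite addn_minr leq_min -!big_split /=; apply/andP; split.
  by apply: leq_sum => u _; rewrite (deg_inD1 u vW); lia.
apply: leq_sum => u _; rewrite (deg_inD1 u vW).
by case: (e u v); case: ltnP; lia.
Qed.

Lemma gsum0D1 W v : v \in W ->
  gsum (W :\ v) 0 + (deg_in W v).*2 = gsum W 0.
Proof.
move=> vW; rewrite /gsum [RHS](big_setD1 v) //= subn0 -addnn addnA addnC.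
congr (_ + _); have -> : deg_in W v = \sum_(u in W :\ v) e u v.
  by rewrite deg_in_sum (big_setD1 v) //= e_irr.
by rewrite -big_split /=; apply: eq_bigr => u _; rewrite (deg_inD1 u vW); lia.
Qed.

(** Decrementing the largest degrees lowers the profile at least as much as decrementing the
    neighbours of [v]. *)
Lemma hstep_gsum W v : v \in W -> (forall u, u \in W -> deg_in W u <= deg_in W v) ->
  forall t, hstep (gsum W) t <= gsum (W :\ v) t.
Proof.
move=> vW vmax t; have pP := gsum_profile W.
have Ed : \max_(u in W) deg_in W u = deg_in W v.
  apply/eqP; rewrite eqn_leq (leq_bigmax_cond _ vW) andbT.
  by apply/bigmax_leqP.
rewrite Ed in pP; rewrite (hstepE pP); case: ltnP => // ltd.
have := gsumD1 t vW.
have sh : gsum W t.+1 = deg_in W v - t.+1 + \sum_(u in W :\ v) (deg_in W u - t.+1).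
  by rewrite /gsum (big_setD1 v).
have sk : gsum W t = deg_in W v - t + \sum_(u in W :\ v) (deg_in W u - t).
  by rewrite /gsum (big_setD1 v).
have : \sum_(u in W :\ v) (deg_in W u - t) = \sum_(u in W :\ v) (deg_in W u - t.+1)
    + \sum_(u in W :\ v) (t < deg_in W u).
  by rewrite -big_split /=; apply: eq_bigr => u _ /=; case: ltnP; lia.
by lia.
Qed.

(** Deletes a vertex of maximum degree [k] times or until none is left; [gsum U 0] is twice the
    number of edges inside [U]. *)
Lemma remove_max k W : exists U : {set T},
  [/\ U \subset W, #|W| <= #|U| + k & gsum U 0 + (hsum k (gsum W)).*2 <= gsum W 0].
Proof.
elim: k W => [|k IH] W; first by exists W; rewrite subxx !addn0.
have [->|[v0 v0W]] := set_0Vmem W.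
  exists set0; split; rewrite ?cards0 //.
  have := gsum_profile set0; rewrite big_set0 => /hsum0 ->.
  by rewrite addn0.
pose v := [arg max_(i > v0 in W) deg_in W i].
have [vW vmax] : v \in W /\ forall u, u \in W -> deg_in W u <= deg_in W v.
  by rewrite /v; case: arg_maxnP.
have [U [sU cU gU]] := IH (W :\ v); exists U; split.
- exact: subset_trans sU (subsetDl _ _).
- by rewrite (cardsD1 v W) vW; lia.
have pP := gsum_profile W; have [E _ pE] := hstep_profile pP.
have := hsum_mono k pE (gsum_profile _) (hstep_gsum vW vmax).
have := gsum0D1 vW; rewrite /= (topE pP).
have -> : \max_(u in W) deg_in W u = deg_in W v.
  apply/eqP; rewrite eqn_leq (leq_bigmax_cond _ vW) andbT.
  by apply/bigmax_leqP.
by lia.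
Qed.

Lemma gsum0_independent W : gsum W 0 = 0 -> {in W &, forall x y, ~~ e x y}.
Proof.
move=> /eqP; rewrite sum_nat_eq0 => /forall_inP z x y xW yW.
have := z x xW; rewrite subn0 cards_eq0 => /eqP/setP/(_ y).
by rewrite !inE yW /= => ->.
Qed.

End Graph.

Lemma leq_independence (G : sgraph) (S : {set G}) :
  {in S &, forall x y, ~~ adj x y} -> #|S| <= independence_number G.
Proof.
move=> iS; apply: leq_bigmax_cond.
by apply/forall_inP => x xS; apply/forall_inP => y yS; apply: iS.
Qed.

Lemma degree_setT (G : sgraph) (x : G) : deg_in (@adj G) setT x = degree x.
Proof. by apply: eq_card => y; rewrite !inE. Qed.

(** If Havel-Hakimi takes [k] steps, the residue is [n - k], and [k] deletions leave an edgeless set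
    of at least [n - k] vertices. *)
Theorem residue_independence (G : sgraph) : residue G <= independence_number G.
Proof.
set s := sort geq (degrees G).
have ss : sorted geq s by apply: sort_sorted => a b; apply: leq_total.
have [k Ek le_k] := hh_reduce_hsum ss (leqnn _).
have sG : size s = #|G| by rewrite size_sort size_map -cardE.
have sgE t : psum s t = gsum (@adj G) setT t.
  rewrite /psum (perm_big _ (permEl (perm_sort _ _))) /= big_map big_enum /=.
  by apply: eq_big => [x|x _]; rewrite ?inE // degree_setT.
have [U [_ cU gU]] := remove_max (@adj_sym G) (@adj_irr G) k setT.
have le_h : hsum k (psum s) <= hsum k (gsum (@adj G) setT).
  by apply: hsum_mono (psum_profile _) (gsum_profile _ _) _ => t; rewrite sgE.
have /gsum0_independent iU : gsum (@adj G) U 0 = 0 by move: le_k; rewrite sgE; lia.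
have := leq_independence iU; rewrite cardsT in cU.
by rewrite /residue -/s; lia.
Qed.

(** * Independent sets in graphs without large cliques *)

Section Brooks.
Variable T : finType.
Implicit Types (e : rel T) (W K S : {set T}).

Definition clique e K := {in K &, forall x y, x != y -> e x y}.
Definition indep e S := {in S &, forall x y, ~~ e x y}.

Lemma card_le_deg e W (A : {set T}) v :
  A \subset W -> (forall u, u \in A -> e v u) -> #|A| <= deg_in e W v.
Proof.
move=> sA eA; apply: subset_leq_card; apply/subsetP => u uA.
by rewrite inE (subsetP sA) ?eA.
Qed.

(* In a maximum independent set [S], the vertices seeing only [s] in [S] form a
   clique with [s], hence are at most [D - 2]; all others see [S] twice. *)
Lemma clique_free_independent e W D :
    symmetric e -> irreflexive e -> 1 < D ->
    (forall v, v \in W -> deg_in e W v <= D) ->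
    (forall K, K \subset W -> clique e K -> #|K| < D) ->
  exists S, [/\ S \subset W, indep e S & #|W| <= D * #|S|].
Proof.
move=> e_sym e_irr D1 degW cliW.
pose ind S := (S \subset W) && [forall x in S, forall y in S, ~~ e x y].
have indP S : reflect (S \subset W /\ indep e S) (ind S).
  apply: (iffP andP) => -[sW iS]; split=> //.
    by move=> x y xS yS; exact: (forall_inP (forall_inP iS x xS) y yS).
  by apply/forall_inP => x xS; apply/forall_inP => y yS; exact: iS.
have ind0 : ind set0.
  by apply/indP; split; [exact: sub0set|move=> x y; rewrite inE].
have [S /indP [sW iS] maxS] := arg_maxnP (fun S => #|S|) ind0.
exists S; split=> //.
pose b v := \sum_(s in S) e v s.
pose Pr s := [set v in W :\: S | (b v == 1) && e v s].
have b1P v s s' : b v = 1 -> s \in S -> s' \in S -> e v s -> e v s' -> s' = s.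
  move=> bv sS s'S es es'; apply/eqP; apply: contraPT bv => ne.
  by rewrite /b (bigD1 s) //= es (bigD1 s') /= ?es' ?s'S //; lia.
have Prs s : s \in S -> (#|Pr s|).+1 < D.
  move=> sS; have sNPr : s \notin Pr s by rewrite !inE sS.
  have : #|s |: Pr s| < D; last by rewrite cardsU1 sNPr.
  apply: cliW.
    apply/subsetP => x; rewrite !inE => /orP [/eqP->|/andP [/andP [_ ->]] //].
    exact: (subsetP sW).
  have Padj x : x \in Pr s -> e x s by rewrite !inE => /and3P [].
  move=> x y; rewrite in_setU1 => /orP [/eqP->|xP];
    rewrite in_setU1 => /orP [/eqP->|yP]; rewrite ?eqxx // => nexy.
  - by rewrite e_sym; exact: Padj.
  - exact: Padj.
  (* Otherwise [x] and [y] could replace [s] in [S]. *)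
  apply: contraT => nadj.
  have xS : x \notin S by move: xP; rewrite !inE => /andP [/andP []].
  have yS : y \notin S by move: yP; rewrite !inE => /andP [/andP []].
  have only z t : z \in Pr s -> t \in S :\ s -> ~~ e z t.
    move=> zP; rewrite !inE => /andP [nts tS]; apply: contra nts => ezt; apply/eqP.
    by apply: (b1P z) => //; [move: zP; rewrite !inE => /and3P [_ /eqP]|exact: Padj].
  have : ind (x |: (y |: (S :\ s))).
    apply/indP; split.
      apply/subsetP => z; rewrite !inE => /or3P [/eqP->|/eqP->|/andP [_]].
      + by move: xP; rewrite !inE => /andP [/andP []].
      + by move: yP; rewrite !inE => /andP [/andP []].
      + exact: (subsetP sW).
    move=> z t; rewrite !in_setU1 => /or3P [/eqP->|/eqP->|zS] /or3P [/eqP->|/eqP->|tS];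
      rewrite ?e_irr //.
    + exact: only.
    + by rewrite e_sym.
    + exact: only.
    + by rewrite e_sym; exact: only.
    + by rewrite e_sym; exact: only.
    + by apply: iS; [case/setD1P: zS|case/setD1P: tS].
  move/maxS; rewrite !cardsU1 !inE (negPf xS) (negPf yS) !andbF orbF nexy /=.
  by rewrite (cardsD1 s S) sS ltnn.
have bpos v : v \in W :\: S -> 0 < b v.
  rewrite inE => /andP [vS vW]; rewrite lt0n; apply/negP; rewrite sum_nat_eq0 => /forall_inP z.
  have nv s : s \in S -> ~~ e v s by move=> sS; have := z s sS; case: (e v s).
  have : ind (v |: S).
    apply/indP; split.
      by apply/subsetP => x; rewrite !inE => /orP [/eqP->|/(subsetP sW)].
    move=> x y; rewrite !in_setU1 => /orP [/eqP->|xS] /orP [/eqP->|yS].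
    - by rewrite e_irr.
    - exact: nv.
    - by rewrite e_sym; exact: nv.
    - exact: iS.
  by move/maxS; rewrite cardsU1 vS; lia.
have cW : #|W| = #|S| + #|W :\: S| by rewrite -(cardsID S W) (setIidPr sW).
have sumb : \sum_(v in W :\: S) b v <= D * #|S|.
  rewrite /b exchange_big /= mulnC -sum_nat_const; apply: leq_sum => s sS.
  apply: leq_trans (degW s (subsetP sW s sS)); rewrite deg_in_sum //.
  rewrite [leqRHS](big_setID S) /=; lia.
have two : #|W :\: S|.*2 <= \sum_(v in W :\: S) b v + \sum_(s in S) #|Pr s|.
  have -> : \sum_(s in S) #|Pr s| = \sum_(v in W :\: S) \sum_(s in S) ((b v == 1) && e v s).
    rewrite exchange_big; apply: eq_bigr => s _.
    rewrite -sum1_card big_mkcond [RHS]big_mkcond; apply: eq_bigr => v _.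
    by rewrite inE; case: (v \in _) => //; case: (_ && _).
  rewrite -big_split /= -muln2 -sum_nat_const; apply: leq_sum => v vW.
  have := bpos v vW; case: eqP => [b1|] /=; last by lia.
  by rewrite -/(b v); lia.
(* Together: [2 |W - S| <= D |S| + (D - 2) |S|]. *)
have : \sum_(s in S) #|Pr s| <= \sum_(s in S) D.-2.
  by apply: leq_sum => s /Prs; lia.
rewrite sum_nat_const cW; nia.
Qed.

(** Induction on the size. A clique [K] on [D] vertices is cut off and contributes one vertex [c],
    provided the set found in the rest avoids the neighbours of [c], of which there is at most
    one. *)
Lemma brooks_independent D n e W :
    2 < D -> symmetric e -> irreflexive e -> #|W| <= n ->
    (forall v, v \in W -> deg_in e W v <= D) ->
    (forall K, K \subset W -> clique e K -> #|K| <= D) ->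
  exists S, [/\ S \subset W, indep e S & #|W| <= D * #|S|].
Proof.
move=> D2; elim: n e W => [|n IH] e W e_sym e_irr lenW degW cliW.
  exists set0; split; [exact: sub0set|by move=> x y; rewrite inE|lia].
pose isK (K : {set T}) := [&& K \subset W,
  [forall x in K, forall y in K, (x != y) ==> e x y] & #|K| == D].
have [/existsP [K /and3P [sK /forall_inP cK' /eqP cardK]]|noK] :=
    boolP [exists K, isK K]; last first.
  apply: clique_free_independent => //; first exact: ltnW.
  move=> K sK cK; rewrite ltn_neqAle cliW // andbT.
  apply: contra noK => cardK; apply/existsP; exists K; rewrite /isK sK cardK andbT.
  apply/forall_inP => x xK; apply/forall_inP => y yK; apply/implyP; exact: cK.
have cK : clique e K.
  by move=> x y xK yK; apply/implyP; exact: (forall_inP (cK' x xK)).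
set W' := W :\: K.
have cW : #|W| = D + #|W'| by rewrite -(cardsID K W) (setIidPr sK) cardK.
have sW' : W' \subset W by apply: subsetDl.
have W'nK u : u \in W' -> u \notin K by rewrite inE => /andP [].
clearbody W'.
have extend S c : S \subset W' -> indep e S -> c \in K ->
    (forall s, s \in S -> ~~ e c s) -> #|W'| <= D * #|S| ->
    exists S, [/\ S \subset W, indep e S & #|W| <= D * #|S|].
  move=> sS iS cK1 nc leW'; exists (c |: S); split.
  - by rewrite subUset sub1set (subsetP sK) // (subset_trans sS).
  - move=> x y; rewrite !in_setU1 => /orP [/eqP->|xS] /orP [/eqP->|yS].
    + by rewrite e_irr.
    + exact: nc.
    + by rewrite e_sym; exact: nc.
    + exact: iS.
  - rewrite cardsU1; have -> /= : c \notin S.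
      by apply: contraL cK1 => /(subsetP sS) /W'nK.
    by rewrite cW; nia.
have outK c u : c \in K -> u \in W' -> e c u -> forall w, w \in W' -> e c w -> w = u.
  move=> cK1 uW ecu w wW ecw; apply/eqP; apply: contraT => newu.
  have := degW c (subsetP sK c cK1); rewrite leqNgt => /negP [].
  have : #|w |: (u |: (K :\ c))| <= deg_in e W c.
    apply: card_le_deg.
      rewrite !subUset !sub1set !(subsetP sW') //=.
      exact: subset_trans (subsetDl _ _) sK.
    move=> x; rewrite !in_setU1 => /or3P [/eqP->|/eqP->|/setD1P [nex xK]] //.
    by apply: cK; rewrite // eq_sym.
  apply: leq_trans; rewrite !cardsU1 !inE (negPf newu) /=.
  rewrite (negPf (W'nK _ wW)) (negPf (W'nK _ uW)) !andbF /=.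
  by move: cardK; rewrite (cardsD1 c K) cK1; clear; lia.
have degW' v : v \in W' -> deg_in e W' v <= D.
  move=> vW; apply: leq_trans (degW v (subsetP sW' v vW)).
  apply: card_le_deg => [|u]; last by rewrite inE => /andP [].
  by apply: subset_trans sW'; apply/subsetP => u; rewrite inE => /andP [].
have [/forall_inP allK|] := boolP [forall c in K, exists u in W', e c u]; last first.
  case/forall_inPn => c cK1 /exists_inPn nc.
  have [S [sS iS leW']] : exists S, [/\ S \subset W', indep e S & #|W'| <= D * #|S|].
    apply: IH => //; first by lia.
    by move=> K1 sK1; apply: cliW; apply: subset_trans sW'.
  by apply: (extend S c) => // s /(subsetP sS); apply: nc.
pose f c := odflt c [pick u in W' | e c u].
have fP c : c \in K -> f c \in W' /\ e c (f c).
  move=> cK1; rewrite /f; case: pickP => [u /andP [] //|none].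
  by have /exists_inP [u uW ecu] := allK c cK1; have := none u; rewrite uW ecu.
have fE c u : c \in K -> u \in W' -> e c u -> u = f c.
  by move=> cK1 uW ecu; have [fW ef] := fP c cK1; exact: (outK c (f c)).
(* One neighbour of [f c] lies in [K], which leaves room for a new edge. *)
have deg_lt c : c \in K -> deg_in e W' (f c) < D.
  move=> cK1; have [fW ef] := fP c cK1.
  apply: leq_trans (degW _ (subsetP sW' _ fW)).
  have : #|c |: [set u in W' | e (f c) u]| <= deg_in e W (f c).
    apply: card_le_deg.
      rewrite subUset sub1set (subsetP sK) //=.
      by apply: subset_trans sW'; apply/subsetP => u; rewrite inE => /andP [].
    move=> u; rewrite in_setU1 inE => /orP [/eqP->|/andP [] //].
    by rewrite e_sym.
  have cNW : c \notin W' by apply: contraL cK1 => /W'nK.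
  by rewrite cardsU1 inE (negPf cNW).
(* Joining two outer neighbours [u], [w] of the clique forces an independent
   set to miss one of them, which leaves room for a vertex of [K]. *)
pose e' u w x y := [|| e x y, (x == u) && (y == w) | (x == w) && (y == u)].
pose good c1 c2 := forall X : {set T}, X \subset W' -> clique (e' (f c1) (f c2)) X -> #|X| <= D.
have good_done c1 c2 : c1 \in K -> c2 \in K -> f c1 != f c2 -> good c1 c2 ->
    exists S, [/\ S \subset W, indep e S & #|W| <= D * #|S|].
  move=> c1K c2K ne12 gd; have [f1W ef1] := fP c1 c1K; have [f2W ef2] := fP c2 c2K.
  have [S [sS iS leW']] : exists S,
      [/\ S \subset W', indep (e' (f c1) (f c2)) S & #|W'| <= D * #|S|].
    apply: IH => //; last 1 first.
    - move=> v vW; rewrite /deg_in.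
      have sub1 : [set u in W' | e' (f c1) (f c2) v u] \subset
          [set u in W' | e v u] :|: (if v == f c1 then [set f c2] else
            if v == f c2 then [set f c1] else set0).
        apply/subsetP => u; rewrite !inE /e'.
        case: (u \in W') => //=; case/or3P => [->//|/andP [/eqP-> /eqP->]|/andP [/eqP-> /eqP->]].
          by rewrite eqxx inE eqxx orbT.
        by rewrite eq_sym (negPf ne12) eqxx inE eqxx orbT.
      apply: leq_trans (subset_leq_card sub1) _.
      apply: leq_trans (leq_card_setU _ _).1 _.
      have [->|_] := eqVneq v (f c1).
        by rewrite cards1 addn1; exact: deg_lt.
      have [->|_] := eqVneq v (f c2).
        by rewrite cards1 addn1; exact: deg_lt.
      by rewrite cards0 addn0; exact: degW'.
    - move=> x y; rewrite /e' e_sym; congr (_ || _).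
      by rewrite orbC andbC [X in _ || X]andbC.
    - move=> x; rewrite /e' e_irr /=; apply/negP => /orP [] /andP [/eqP-> ];
      by rewrite ?(negPf ne12) // eq_sym (negPf ne12).
    - by clear -lenW cW D2; lia.
  have iS' : indep e S.
    by move=> x y xS yS; have := iS x y xS yS; rewrite /e' negb_or => /andP [].
  have [f1S|f1S] := boolP (f c1 \in S).
    have f2S : f c2 \notin S.
      by apply/negP => f2S; have := iS _ _ f1S f2S; rewrite /e' !eqxx orbT.
    apply: (extend S c2) => // s sS1; apply: contra f2S => ecs.
    by rewrite -(fE c2 s) // (subsetP sS).
  apply: (extend S c1) => // s sS1; apply: contra f1S => ecs.
  by rewrite -(fE c1 s) // (subsetP sS).
have [c1 c1K] : exists c, c \in K by apply/card_gt0P; rewrite cardK; clear -D2; lia.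
have [f1W ef1] := fP c1 c1K.
(* If all outer neighbours coincided, [K] with that vertex would be a clique on [D.+1] vertices. *)
have [c2 c2K ne12] : exists2 c2, c2 \in K & f c1 != f c2.
  apply/exists_inP; apply: contraT => /exists_inPn same.
  have : #|f c1 |: K| <= D.
    apply: cliW.
      by rewrite subUset sub1set (subsetP sW') // sK.
    have adj1 c : c \in K -> e c (f c1).
      by move=> cK1; have := same c cK1; rewrite negbK => /eqP->; case: (fP c cK1).
    move=> x y; rewrite !in_setU1 => /orP [/eqP->|xK] /orP [/eqP->|yK].
    - by rewrite eqxx.
    - by rewrite e_sym => _; exact: adj1.
    - by move=> _; exact: adj1.
    - exact: cK.
  by rewrite cardsU1 (W'nK _ f1W) cardK; lia.
have [f2W ef2] := fP c2 c2K.
pose goodb a c := [forall X : {set T}, (X \subset W') ==>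
  [forall x in X, forall y in X, (x != y) ==> e' (f a) (f c) x y] ==>
  (#|X| <= D)].
have goodP a c : reflect (good a c) (goodb a c).
  apply: (iffP forallP) => h X.
    move=> sX cX; have := h X; rewrite sX /= => /implyP; apply.
    by apply/forall_inP => x xX; apply/forall_inP => y yX; apply/implyP; exact: cX.
  apply/implyP => sX; apply/implyP => /forall_inP cX; apply: h => // x y xX yX.
  by apply/implyP; exact: (forall_inP (cX x xX)).
(* A pair fails only if its end [f a] has all its remaining neighbours in the
   clique [X0], which are also adjacent to [f c]. *)
have bad a c : a \in K -> c \in K -> f a != f c -> ~ good a c ->
    exists X0 : {set T},
      [/\ X0 \subset [set u in W' | e (f a) u], D.-1 <= #|X0|,
          f c \notin X0, f a \notin X0 & clique e X0] /\
      forall x, x \in X0 -> e x (f a) /\ e x (f c).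
  move=> aK cK1 neac /goodP; rewrite negb_forall => /existsP [X].
  rewrite !negb_imply -ltnNge => /and3P [sX /forall_inP cX' ltX].
  have cX : clique (e' (f a) (f c)) X.
    by move=> x y xX yX; apply/implyP; exact: (forall_inP (cX' x xX)).
  have [faX fcX] : f a \in X /\ f c \in X.
    apply/andP; apply: contraLR ltX => nac; rewrite -leqNgt; apply: cliW.
      exact: subset_trans sW'.
    move=> x y xX yX nexy; have := cX x y xX yX nexy.
    case/or3P=> [//|/andP [/eqP xE /eqP yE]|/andP [/eqP xE /eqP yE]];
      by move: nac; rewrite -xE -yE xX yX.
  have out x y : x \in X -> y \in X -> x != y -> x != f a -> x != f c -> e x y.
    move=> xX yX nexy nxa nxc; have := cX x y xX yX nexy.
    by rewrite /e' (negPf nxa) (negPf nxc) !orbF.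
  exists ((X :\ f a) :\ f c); split; first split.
  - apply/subsetP => x /setD1P [nxc /setD1P [nxa xX]]; rewrite inE (subsetP sX) //=.
    by rewrite e_sym; exact: out.
  - move: ltX; rewrite (cardsD1 (f a) X) faX (cardsD1 (f c) (X :\ f a)).
    by rewrite !inE fcX eq_sym neac /= !add1n ltnS -subn1 leq_subLR.
  - by rewrite !inE eqxx.
  - by rewrite !inE eqxx andbF.
  - by move=> x y /setD1P [nxc /setD1P [nxa xX]] /setD1P [_ /setD1P [_ yX]] ne; exact: out.
  - by move=> x /setD1P [nxc /setD1P [nxa xX]]; split; exact: out.
have [/goodP|/goodP bad12] := boolP (goodb c1 c2).
  exact: good_done.
have [/goodP|/goodP bad21] := boolP (goodb c2 c1).
  by apply: good_done; rewrite // eq_sym.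
(* [f a] already has [a] and [D.-1] neighbours in [W']; a further neighbour [d] would exceed degree
   [D]. *)
have uniq a c d : a \in K -> c \in K -> f a != f c -> ~ good a c ->
    d \in K -> d != a -> f d != f a.
  move=> aK cK1 neac /bad [] // X0 [[sX0 cardX0 _ _ _] X0a] dK neda.
  apply/eqP => fda; have [fW ef] := fP a aK.
  have := degW _ (subsetP sW' _ fW); rewrite leqNgt => /negP [].
  have : #|d |: (a |: X0)| <= deg_in e W (f a).
    apply: card_le_deg.
      rewrite !subUset !sub1set !(subsetP sK) //=; apply: subset_trans sW'.
      by apply/subsetP => x /(subsetP sX0); rewrite inE => /andP [].
    move=> x; rewrite !in_setU1 => /or3P [/eqP->|/eqP->|/X0a []]; rewrite e_sym //.
    by rewrite -fda; case: (fP d dK).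
  apply: leq_trans; rewrite !cardsU1 !inE (negPf neda) /=.
  have nX0 b : b \in K -> b \notin X0.
    by move=> bK; apply: contraL bK => /(subsetP sX0); rewrite inE => /andP [/W'nK].
  by rewrite !nX0 //=; clear -cardX0 D2; lia.
have [c3] : exists c3, c3 \in K :\: [set c1; c2].
  apply/card_gt0P; rewrite cardsDS; last by rewrite subUset !sub1set c1K.
  by rewrite cards2 cardK; clear -D2; case: (_ != _); lia.
rewrite !inE negb_or => /andP [/andP [n31 n32] c3K].
have [f3W ef3] := fP c3 c3K.
have ne31 := uniq _ _ _ c1K c2K ne12 bad12 c3K n31.
have ne32 : f c3 != f c2 by apply: (uniq c2 c1) => //; rewrite eq_sym.
have ne13 : f c1 != f c3 by rewrite eq_sym.
have [/goodP|/goodP bad13] := boolP (goodb c1 c3).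
  exact: good_done.
(* Both cliques fill the neighbourhood of [f c1] in [W'], so they coincide. A vertex of [X] then
   sees the rest of [X] and all of [f c1], [f c2], [f c3]: too many neighbours. *)
have [X [[sX cardX f2X f1X cX] Xc2]] := bad c1 c2 c1K c2K ne12 bad12.
have [Y [[sY cardY f3Y _ _] Yc3]] := bad c1 c3 c1K c3K ne13 bad13.
have degf1 := deg_lt c1 c1K.
have EX : X = [set u in W' | e (f c1) u].
  by apply/eqP; rewrite eqEcard sX; move: degf1; rewrite /deg_in; clear -cardX; lia.
have EY : Y = X.
  by apply/eqP; rewrite EX eqEcard sY; move: degf1; rewrite /deg_in; clear -cardY; lia.
subst Y; have [x xX] : exists x, x \in X by apply/card_gt0P; clear -cardX D2; lia.
have xW : x \in W' by move: (subsetP sX _ xX); rewrite inE => /andP [].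
have := degW _ (subsetP sW' _ xW); rewrite leqNgt => /negP [].
have : #|f c1 |: (f c2 |: (f c3 |: (X :\ x)))| <= deg_in e W x.
  apply: card_le_deg.
    rewrite !subUset !sub1set !(subsetP sW') //=; apply: subset_trans sW'.
    apply/subsetP => y; rewrite inE => /andP [_ /(subsetP sX)].
    by rewrite inE => /andP [].
  move=> y; rewrite !in_setU1 => /or4P [/eqP->|/eqP->|/eqP->|/setD1P [ne yX]].
  - by case: (Xc2 x xX).
  - by case: (Xc2 x xX).
  - by case: (Yc3 x xX).
  - by apply: cX; rewrite // eq_sym.
apply: leq_trans; rewrite !cardsU1 !inE (negPf ne12) (negPf ne13) (negPf f1X).
rewrite (negPf f2X) (negPf f3Y) [f c2 == _]eq_sym (negPf ne32) !andbF /=.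
by move: cardX; rewrite (cardsD1 x X) xX; clear -D2; lia.
Qed.
End Brooks.

(** * The annihilation number *)

Section Bounds.
Variable G : sgraph.
Implicit Types (x y : G) (W S : {set G}).
Local Notation n := (num_vertices G).
Local Notation m := (num_edges G).
Local Notation D := (max_degree G).

Lemma degree_edges x : degree x = #|[set E in edges G | x \in E]|.
Proof.
have inj : {in [set y | adj x y] &, injective (fun y => [set x; y])}.
  move=> y z; rewrite !inE => axy axz /setP/(_ y).
  rewrite !inE eqxx orbT => /esym/orP [/eqP Ey|/eqP //].
  by rewrite Ey adj_irr in axy.
rewrite /degree -(card_in_imset inj); apply: eq_card => E; apply/imsetP/idP.
  move=> [y]; rewrite inE => axy ->; rewrite !inE eqxx andbT.
  by apply/existsP; exists x; apply/existsP; exists y; rewrite axy eqxx.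
rewrite !inE => /andP [/existsP [u /existsP [w /andP [auw /eqP ->]]]].
rewrite !inE => /orP [] /eqP ->; [exists w|exists u]; rewrite ?inE //.
  by rewrite adj_sym.
by rewrite setUC.
Qed.

Lemma handshake : \sum_(x : G) degree x = m.*2.
Proof.
under eq_bigr => x _ do rewrite degree_edges -sum1_card big_mkcond.
rewrite exchange_big /= -muln2 /num_edges -sum_nat_const [RHS]big_mkcond.
apply: eq_bigr => E _; rewrite -big_mkcond /=.
under eq_bigl => x do rewrite inE.
have [|_] := boolP (E \in edges G); last by rewrite big_pred0.
rewrite inE => /existsP [u /existsP [w /andP [auw /eqP ->]]] /=.
rewrite sum1_card cards2; case: eqP => // uw.
by rewrite uw adj_irr in auw.
Qed.

Lemma degree_le x : degree x <= D.
Proof. exact: leq_bigmax. Qed.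

Lemma sumn_degrees : sumn (sort leq (degrees G)) = m.*2.
Proof.
rewrite -handshake sumnE (perm_big _ (permEl (perm_sort _ _))) /= big_map.
by rewrite big_enum.
Qed.

Lemma size_degrees : size (sort leq (degrees G)) = n.
Proof. by rewrite size_sort size_map -cardE. Qed.

(** The [a] smallest degrees sum to at most [m] out of [2m], so the [n - a] others, each at most
    [D], sum to at least [m]. *)
Lemma annihilation_bound : annihilation_number G * D + m <= n * D.
Proof.
rewrite /annihilation_number.
set s := sort leq (degrees G); pose p (k : 'I_n.+1) := sumn (take k s) <= m.
rewrite (eq_bigl p) //.
have [k pk ->] : {k : 'I_n.+1 | p k & \max_(k < n.+1 | p k) k = k}.
  by apply: eq_bigmax_cond; apply/card_gt0P; exists ord0; rewrite unfold_in /p take0.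
rewrite /p in pk.
have := sumn_degrees; rewrite -/s -(cat_take_drop k s) sumn_cat => Es.
have leD : sumn (drop k s) <= (n - k) * D.
  have -> : n - k = size (drop k s) by rewrite size_drop size_degrees.
  rewrite sumnE -sum1_size big_distrl /=.
  rewrite !big_seq; apply: leq_sum => d /mem_drop.
  by rewrite mem_sort mul1n => /mapP [x _ ->]; exact: degree_le.
have : k <= n by rewrite -ltnS.
by move: leD; rewrite mulnBl; have := leq_mul2r D k n; lia.
Qed.

Hypothesis cG : connected G.

Lemma leaving_edge W : W != set0 -> W != setT ->
  exists x y, [/\ x \in W, y \notin W & adj x y].
Proof.
move=> /set0Pn [x xW] WT.
have [y yW] : exists y, y \notin W.
  by apply/existsP; apply: contraNT WT => /existsPn h; apply/eqP/setP => z;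
     rewrite inE; have := h z; rewrite negbK.
have [/existsP [u /existsP [w /and3P [uW wW auw]]]|] :=
    boolP [exists u, exists w, [&& u \in W, w \notin W & adj u w]].
  by exists u, w.
move=> /existsPn none.
have cl : closed (@adj G) (mem W).
  apply: intro_closed => [|u w auw uW].
    by apply: sym_connect_sym; exact: adj_sym.
  have /existsPn/(_ w) := none u; rewrite uW auw andbT /=.
  by rewrite negbK.
have := closed_connect cl (forallP (forallP cG x) y).
by rewrite /= xW (negPf yW).
Qed.

(** A set grown along leaving edges gains at least one edge per new vertex; [gsum] counts edges
    twice. *)
Lemma connected_edges : n <= m.+1.
Proof.
suff grow k : k < n -> exists W, #|W| = k.+1 /\ k.*2 <= gsum (@adj G) W 0.
  case En : n => [//|k]; have [|W [cW gW]] := grow k; first by rewrite En.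
  have WT : W = setT by apply/eqP; rewrite eqEcard subsetT cW cardsT -En leqnn.
  rewrite ltnS -leq_double -handshake; apply: leq_trans gW _.
  rewrite WT /gsum; under eq_bigr => x _ do rewrite subn0 degree_setT.
  by apply: eq_leq; apply: eq_bigl => x; rewrite inE.
elim: k => [/card_gt0P [x _]|k IH ltk].
  by exists [set x]; rewrite cards1.
have [W [cW gW]] := IH (ltnW ltk).
have [||x [y [xW yW axy]]] := @leaving_edge W.
- by rewrite -card_gt0 cW.
- by apply: contraTneq ltk => WT; rewrite -cW WT cardsT -leqNgt.
exists (y |: W); rewrite cardsU1 yW cW; split=> //.
have yyW : y \in y |: W by rewrite !inE eqxx.
rewrite -(gsum0D1 (@adj_sym G) (@adj_irr G) yyW) setU1K //.
suff : 0 < deg_in (@adj G) (y |: W) y by lia.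
by apply/card_gt0P; exists x; rewrite !inE xW orbT adj_sym.
Qed.

Hypothesis n3 : 2 < n.

Lemma sum_degree_le : m.*2 <= n * D.
Proof.
rewrite -handshake -sum_nat_const.
by apply: leq_sum => x _; exact: degree_le.
Qed.

Lemma max_degree_gt1 : 1 < D.
Proof.
have := sum_degree_le; have := connected_edges; move: n3.
by case: D => [|[|d]] //; lia.
Qed.

Lemma indep_add W x S : S \subset W :\: (x |: [set y | adj x y]) ->
  indep (@adj G) S -> indep (@adj G) (x |: S) /\ #|x |: S| = #|S|.+1.
Proof.
move=> sS iS; have nS y : y \in S -> ~~ adj x y /\ y != x.
  by move/(subsetP sS); rewrite !inE negb_or => /andP [/andP [-> ->]].
split; last by rewrite cardsU1; case: (boolP (x \in S)) => // /nS []; rewrite eqxx.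
move=> u w; rewrite !in_setU1 => /orP [/eqP->|uS] /orP [/eqP->|wS].
- by rewrite adj_irr.
- by case: (nS w wS).
- by rewrite adj_sym; case: (nS u uS).
- exact: iS.
Qed.

Lemma greedy_add W x S : x \in W -> deg_in (@adj G) W x <= 1 ->
    S \subset W :\: (x |: [set y | adj x y]) -> indep (@adj G) S ->
    #|W :\: (x |: [set y | adj x y])| <= (#|S|).*2 ->
  [/\ x |: S \subset W, indep (@adj G) (x |: S) & #|W| <= (#|x |: S|).*2].
Proof.
move=> xW dx sS iS cS; have [iS' ->] := indep_add sS iS; split=> //.
  by rewrite subUset sub1set xW (subset_trans sS) ?subsetDl.
have : #|W :&: (x |: [set y | adj x y])| <= 2.
  rewrite setIUr; apply: leq_trans (leq_card_setU _ _).1 _.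
  have -> : W :&: [set y | adj x y] = [set y in W | adj x y] by apply/setP => y; rewrite !inE.
  have := subset_leq_card (subsetIr W [set x]); rewrite cards1.
  by move: dx; rewrite /deg_in; lia.
by rewrite -(cardsID (x |: [set y | adj x y]) W); lia.
Qed.

(* By connectivity a proper subset always has a vertex with a neighbour outside,
   hence of degree at most 1 inside: take it and drop its neighbour. *)
Lemma paths_independent W : D = 2 -> W != setT ->
  exists S, [/\ S \subset W, indep (@adj G) S & #|W| <= (#|S|).*2].
Proof.
move=> D2; elim: {W}#|W| {-2}W (leqnn #|W|) => [|k IH] W leW WT.
  by exists set0; split; [exact: sub0set|move=> x y; rewrite inE|lia].
have [->|W0] := eqVneq W set0.
  by exists set0; split; [exact: sub0set|move=> x y; rewrite inE|rewrite cards0].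
have [x [y [xW yW axy]]] := leaving_edge W0 WT.
have dx : deg_in (@adj G) W x <= 1.
  rewrite -ltnS -D2; apply: leq_trans (degree_le x).
  have : #|y |: [set u in W | adj x u]| <= degree x.
    apply: subset_leq_card; apply/subsetP => u; rewrite !inE.
    by case/orP => [/eqP->|/andP []].
  by rewrite cardsU1 inE (negPf yW).
set W' := W :\: (x |: [set y | adj x y]).
have ltW' : #|W'| < #|W|.
  apply: proper_card; apply/properP; split; first exact: subsetDl.
  by exists x; rewrite // !inE eqxx.
have [||S [sS iS cS]] := IH W'.
- by lia.
- by apply/eqP => /setP/(_ x); rewrite !inE eqxx.
by exists (x |: S); apply: greedy_add.
Qed.

Lemma annihilation_le : annihilation_number G <= independence_number G * D.-1.
Proof.
set a := annihilation_number G; set al := independence_number G.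
have aD : a * D + m <= n * D := annihilation_bound.
have nm := connected_edges; have D1 := max_degree_gt1.
have [D2|D3] : D = 2 \/ 2 < D by lia.
  rewrite D2 muln1; rewrite D2 in aD.
  have [/existsP [x dx]|/existsPn nox] := boolP [exists x : G, degree x <= 1].
    have [|S [sS iS cS]] := @paths_independent (setT :\: (x |: [set y | adj x y])) D2.
      by apply/eqP => /setP/(_ x); rewrite !inE eqxx.
    have [] := greedy_add (in_setT x) _ sS iS cS; first by rewrite degree_setT.
    move=> _ /leq_independence; rewrite -/al cardsT -/n; lia.
  (* All degrees are at least 2, so [m >= n]; this makes up for the vertex removed to break the
     cycle. *)
  have [x _] : exists x : G, x \in G by apply/card_gt0P; rewrite -/n; lia.
  have [|S [sS iS cS]] := @paths_independent (setT :\ x) D2.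
    by apply/eqP => /setP/(_ x); rewrite !inE eqxx.
  have nm2 : n * 2 <= m.*2.
    rewrite -handshake -sum_nat_const; apply: leq_sum => y _.
    by have := nox y; rewrite -ltnNge.
  have := cardsD1 x setT; rewrite in_setT cardsT -/n.
  by have := leq_independence iS; rewrite -/al; lia.
have [/existsP [K /andP [/forall_inP cK ltK]]|/existsPn noK] := boolP [exists K : {set G},
    [forall x in K, forall y in K, (x != y) ==> adj x y] && (D < #|K|)].
  have {}cK : clique (@adj G) K.
    by move=> x y xK yK; apply/implyP; exact: (forall_inP (cK x xK)).
  (* A leaving edge would give a vertex of the clique degree above [D]. *)
  have KT : K = setT.
    apply/eqP; apply: contraLR ltK => KT; rewrite -leqNgt.
    have [->|K0] := eqVneq K set0; first by rewrite cards0.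
    have [x [y [xK yK axy]]] := leaving_edge K0 KT.
    apply: leq_trans (degree_le x); rewrite (cardsD1 x K) xK.
    have : #|y |: (K :\ x)| <= degree x.
      apply: subset_leq_card; apply/subsetP => u; rewrite !inE.
      case/orP => [/eqP->//|/andP [nux uK]].
      by apply: cK; rewrite // eq_sym.
    by rewrite cardsU1 !inE (negPf yK) andbF.
  have lt x : n <= (degree x).+1.
    rewrite -[n]cardsT (cardsD1 x) in_setT add1n ltnS; apply: subset_leq_card.
    apply/subsetP => y; rewrite !inE andbT => nyx.
    by apply: cK; rewrite ?KT // eq_sym.
  have [x _] : exists x : G, x \in G by apply/card_gt0P; rewrite -/n; lia.
  have ltD : D < n by move: ltK; rewrite KT cardsT.
  have nD : n = D.+1 by have := lt x; have := degree_le x; lia.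
  have m2 : n * D <= m.*2.
    rewrite -handshake -sum_nat_const; apply: leq_sum => y _.
    by have := lt y; lia.
  have al1 : 0 < al.
    rewrite -(cards1 x); apply: leq_independence => u w.
    by rewrite !inE => /eqP-> /eqP->; rewrite adj_irr.
  (* [2a <= D + 1] implies [a <= D - 1] as [D > 2]. *)
  have : a.*2 <= n.
    rewrite -(leq_pmul2r (ltnW D1)); lia.
  nia.
have [||S [_ iS cS]] := brooks_independent D3 (@adj_sym G) (@adj_irr G) (leqnn #|[set: G]|).
- by move=> x _; rewrite degree_setT degree_le.
- move=> K _ cK; rewrite leqNgt; apply/negP => ltK; have := noK K; rewrite ltK andbT => /negP [].
  by apply/forall_inP => x xK; apply/forall_inP => y yK; apply/implyP; exact: cK.
have leal := leq_independence iS; rewrite -/al in leal.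
rewrite cardsT -/n in cS.
have nal : n <= D * al by apply: leq_trans cS _; rewrite leq_mul2l leal orbT.
(* [a D <= n D - m <= n (D - 1) + 1]; the surplus 1 vanishes on division by [D > 1]. *)
have : a * D <= al * D.-1 * D + 1.
  clear -aD nm nal D1; case: D aD nal D1 => [//|d] /=; nia.
clear -D1; nia.
Qed.

End Bounds.

(** * Perfect matchings *)

Section Matching.
Variable A : finType.

(** Disjoint edges indexed by [A], the boolean telling their ends apart: [K_2] for [unit], [2 K_2]
    for [bool]. *)
Definition matching_adj (x y : A * bool) := (x.1 == y.1) && (x.2 != y.2).

Lemma matching_sym : symmetric matching_adj.
Proof. by move=> x y; rewrite /matching_adj eq_sym [x.2 == _]eq_sym. Qed.

Lemma matching_irr : irreflexive matching_adj.
Proof. by move=> x; rewrite /matching_adj !eqxx. Qed.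

Definition matching := SGraph matching_sym matching_irr.

Lemma degree_matching (x : matching) : degree x = 1.
Proof.
rewrite /degree -(cards1 ((x.1, ~~ x.2) : matching)); apply: eq_card => -[a b].
by case: x => c d; rewrite !inE xpair_eqE /= /matching_adj /= eq_sym; case: b; case: d.
Qed.

Lemma num_vertices_matching : num_vertices matching = #|A|.*2.
Proof. by rewrite /num_vertices card_prod card_bool muln2. Qed.

Lemma num_edges_matching : num_edges matching = #|A|.
Proof.
apply: double_inj; rewrite -handshake -num_vertices_matching.
by under eq_bigr => x _ do rewrite degree_matching; rewrite sum1_card.
Qed.

Lemma degrees_matching : degrees matching = nseq #|A|.*2 1.
Proof.
rewrite -num_vertices_matching /num_vertices cardE /degrees.
elim: (enum _) => //= x s ->; by rewrite degree_matching.
Qed.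

Lemma max_degree_matching : 0 < #|A| -> max_degree matching = 1.
Proof.
case/card_gt0P => a _; apply/eqP; rewrite eqn_leq; apply/andP; split.
  by apply/bigmax_leqP => x _; rewrite degree_matching.
by rewrite -(degree_matching (a, true)) leq_bigmax.
Qed.

Lemma independence_matching : independence_number matching <= #|A|.
Proof.
apply/bigmax_leqP => S iS.
have inj : {in S &, injective (@fst A bool)}.
  move=> [a b] [c d] xS yS /= ac.
  have := forall_inP (forall_inP iS _ xS) _ yS; rewrite /= /matching_adj /= ac eqxx /=.
  by rewrite negbK => /eqP ->.
by rewrite -(card_in_imset inj) max_card.
Qed.

Lemma sort_nseq (r : rel nat) k x : sort r (nseq k x) = nseq k x.
Proof.
have /all_pred1P -> : all (pred1 x) (sort r (nseq k x)).
  by rewrite all_sort; apply/all_pred1P; rewrite size_nseq.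
by rewrite size_sort size_nseq.
Qed.

Lemma annihilation_matching : #|A| <= annihilation_number matching.
Proof.
have ltA : #|A| < (num_vertices matching).+1 by rewrite num_vertices_matching; lia.
rewrite (_ : #|A| = Ordinal ltA) //; apply: leq_bigmax_cond => /=.
rewrite degrees_matching sort_nseq.
by rewrite num_edges_matching take_nseq ?sumn_nseq ?mul1n // -addnn leq_addr.
Qed.

(** At maximum degree 1 the annihilation number alone already reaches the independence number. *)
Lemma matching_fails :
    0 < #|A| -> 0 < residue matching ->
  ~ ((annihilation_number matching + residue matching)%:R / (max_degree matching)%:R
            <= (independence_number matching)%:R :> rat)%R.
Proof.
move=> A0 r0; rewrite max_degree_matching // GRing.divr1 Num.Theory.ler_nat.
by have := independence_matching; have := annihilation_matching; lia.
Qed.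
End Matching.

(** * The inequality and the counterexamples *)

Theorem theoremE :
  (forall G : sgraph, connected G -> 3 <= num_vertices G ->
     ((annihilation_number G + residue G)%:R / (max_degree G)%:R
        <= (independence_number G)%:R :> rat)%R) /\
  (exists G : sgraph,
     [/\ connected G, num_vertices G < 3, 1 <= max_degree G &
       ~ ((annihilation_number G + residue G)%:R / (max_degree G)%:R
            <= (independence_number G)%:R :> rat)%R]) /\
  (exists G : sgraph,
     [/\ ~ connected G, 3 <= num_vertices G, 1 <= max_degree G &
       ~ ((annihilation_number G + residue G)%:R / (max_degree G)%:R
            <= (independence_number G)%:R :> rat)%R]).
Proof.
split; last split.
- move=> G cG n3; have D1 := max_degree_gt1 cG n3.
  rewrite Num.Theory.ler_pdivrMr ?Num.Theory.ltr0n ?(ltnW D1) //.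
  rewrite -GRing.natrM Num.Theory.ler_nat.
  have := annihilation_le cG n3; have := residue_independence G.
  (* The independence number times [D] splits into one copy for the residue and [D - 1] copies for
     the annihilation number. *)
  by have := mulnS (independence_number G) (max_degree G).-1; rewrite prednK; lia.
- exists (matching unit); split.
  + apply/forallP => -[[] b]; apply/forallP => -[[] c].
    have [->|ne] := eqVneq b c; first exact: connect0.
    by apply: connect1; rewrite /= /matching_adj /= ne.
  + by rewrite num_vertices_matching card_unit.
  + by rewrite max_degree_matching // card_unit.
  + by apply: matching_fails; rewrite /residue ?degrees_matching card_unit.
- exists (matching bool); split.
  + move=> /forallP/(_ (true, true))/forallP/(_ (false, true)).
    have cl : closed (@adj (matching bool)) [pred x | x.1].
      by move=> [a b] [c d] /= /andP [/= /eqP -> _].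
    by move/(closed_connect cl).
  + by rewrite num_vertices_matching card_bool.
  + by rewrite max_degree_matching // card_bool.
  + by apply: matching_fails; rewrite /residue ?degrees_matching card_bool.
Qed.
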